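(* Let $n\ge 1$, let $\tau_d\ge 0$ be an integer, and let $W=[w_{ij}]\in\mathbb{R}^{n\times n}$ be a signed stochastic matrix with nonnegative diagonal. Suppose that each closed strongly connected component (CSCC) of the signed digraph $\mathcal{G}(W)$ contains at least one self-loop (i.e. contains a node $i$ with $w_{ii}>0$). Then the delayed discrete-time system $$X(k+1)=\hat W X(k)+\tilde W X(k-\tau_d)$$ converges, i.e. for every initial condition the limit $\lim_{k\to\infty}X(k)$ exists.
   Context: Signed stochastic matrix: $w_{ij}\in[-1,1]$ and $\sum_{j=1}^n|w_{ij}|=1$ for every $i$; moreover $w_{ii}\ge 0$ for all $i$. $\hat W=\mathrm{diag}\{w_{11},\dots,w_{nn}\}$ and $\tilde W=W-\hat W$. The digraph $\mathcal{G}(W)$ has nodes $1,\dots,n$, and there is an edge from $j$ to $i$ if and only if $w_{ij}\neq 0$; a self-loop at $i$ is present iff $w_{ii}>0$. A strongly connected component (SCC) is a maximal strongly connected subgraph; an SCC with no incoming edges from other SCCs is a closed SCC (CSCC). System: $X(k)=[x_1(k),\dots,x_n(k)]^\top$, with initial condition $X(0)\in[-1,1]^n$; the convention is that $x_i$ stays at its initial value as long as delayed information is unavailable, i.e. $X(0)=X(1)=\dots=X(\tau_d)$, and the recursion is applied for $k\ge\tau_d$. *)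

(* Defs.v *)
From HB Require Import structures.
From mathcomp Require Import all_boot all_order all_algebra.
From mathcomp Require Import all_classical all_reals all_analysis.

Set Implicit Arguments.
Unset Strict Implicit.
Unset Printing Implicit Defensive.

Import Order.TTheory GRing.Theory Num.Theory.
Import numFieldNormedType.Exports.

Local Open Scope ring_scope.

Section Digraph.
Variables (T : finType) (e : rel T).
Implicit Types (S C : {set T}).

Definition induced_rel S : rel T :=
  [rel x y | [&& x \in S, y \in S & e x y]].

(* A strongly connected subgraph is identified with its (nonempty) node set:
   maximality forces a strongly connected component to be an induced subgraph.
   A single node is strongly connected, with or without a self-loop. *)
Definition strongly_connected S : bool :=
  (S != finset.set0) &&
  [forall x in S, forall y in S, connect (induced_rel S) x y].

Definition is_SCC C : bool := maxset strongly_connected C.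

Definition is_CSCC C : Prop :=
  is_SCC C /\
  forall D, is_SCC D -> D != C ->
  forall x y, x \in D -> y \in C -> ~~ e x y.

End Digraph.

Section SignedSystem.
Variables (R : realType) (n : nat).
Implicit Types (W : 'M[R]_n) (X : nat -> 'cV[R]_n).

Definition signed_stochastic W : Prop :=
  (forall i j, -1 <= W i j <= 1) /\ (forall i, \sum_(j < n) `|W i j| = 1).

(* Row index = head, column index = tail: [W i j] weighs the edge j -> i.
   When the diagonal is nonnegative, the self-loop at i is present exactly
   when [0 < W i i]. *)
Definition edge W : rel 'I_n := [rel j i | W i j != 0].

Definition What W : 'M[R]_n := diag_mx (\row_i W i i).

Definition Wtilde W : 'M[R]_n := W - What W.

(* The state is frozen at [X 0] up to time [tau]; from then on the recursion
   applies, so that the subtraction [k - tau] on nat is never truncated. *)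
Definition delayed_trajectory (tau : nat) W X : Prop :=
  (forall k, (k <= tau)%N -> X k = X 0%N) /\
  (forall k, (tau <= k)%N ->
     X k.+1 = What W *m X k + Wtilde W *m X (k - tau)%N).

End SignedSystem.

(* Main.v *)
(** The increments of a bounded solution vanish: let [D] be the largest limsup of
    their absolute values over the nodes.  As the weights of a row have total mass
    1, an increment close to [D] in absolute value forces all the inputs it
    averages to be close to [D] as well.  Going back along a path to a self-loop
    (every node lies downstream of a closed component) yields a node whose
    increments keep one sign and stay close to [D] during arbitrarily long
    periods; if [D > 0], their sum would be unbounded.

    Writing [Q = 1 + tau (1 - What)], a constant history [c] splits as [f + b]
    with [W f = f] and [Q b = (W - 1) u].  The solution with constant history [b]
    is the sequence of increments of another solution, so it vanishes, and the
    solution with history [c] converges to [f].  The splitting exists by a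
    dimension count, as [W f = f] and [Q f = (W - 1) u] force [f = 0]: the constant
    solution [f] is then itself a sequence of increments. *)

Require Import Defs.
From HB Require Import structures.
From mathcomp Require Import all_boot all_order all_algebra.
From mathcomp Require Import all_classical all_reals all_analysis.
From mathcomp Require Import ring lra zify.

Set Implicit Arguments.
Unset Strict Implicit.
Unset Printing Implicit Defensive.

Import Order.TTheory GRing.Theory Num.Theory.
Import numFieldNormedType.Exports.

Local Open Scope classical_set_scope.
Local Open Scope ring_scope.

(** * Closed components upstream of a node *)

Section Digraph.
Variables (T : finType) (e : rel T).

(** A path ending in a set closed under predecessors never leaves it. *)
Lemma connect_induced (S : {set T}) x y :
  (forall a b, e a b -> b \in S -> a \in S) -> y \in S ->
  connect e x y -> connect (induced_rel e S) x y.
Proof.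
move=> Spred yS /connectP[p]; elim: p x => [|z p IH] x /=; first by move=> _ ->.
case/andP=> exz pzy yl; have czy := IH z pzy yl.
have zS : z \in S.
  elim: p z pzy yl {IH exz czy} => [|z' p IH] z /=; first by move=> _ <-.
  by case/andP=> ezz' pz' yl; apply: Spred ezz' _; exact: IH.
apply: connect_trans czy; apply: connect1; rewrite /induced_rel /= exz zS !andbT.
exact: Spred exz zS.
Qed.

Lemma strongly_connected_connect (S : {set T}) x y :
  strongly_connected e S -> x \in S -> y \in S -> connect e x y.
Proof.
case/andP=> _ /forall_inP /(_ x) H xS yS; move/forall_inP: (H xS) => /(_ y yS).
by apply: connect_sub => a b /and3P[_ _ ab]; exact: connect1.
Qed.

(** Among the nodes that reach [i], one with the fewest ancestors is taken; its ancestor set is the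
    closed component. *)
Lemma CSCC_reaches i :
  exists2 C : {set T}, is_CSCC e C & forall x, x \in C -> connect e x i.
Proof.
pose anc j := [set k | connect e k j]%SET.
have [j ji jmin] : exists2 j, connect e j i
    & forall k, connect e k i -> (#|anc j| <= #|anc k|)%N.
  have jP := @arg_minnP _ i (connect e ^~ i) (fun j => #|anc j|) (connect0 e i).
  by case: jP => j ji jmin; exists j.
have anc_sub k : k \in anc j -> anc k \subset anc j.
  rewrite inE => kj; apply/fintype.subsetP=> x; rewrite !inE => xk.
  exact: connect_trans xk kj.
(* By minimality an ancestor [k] of [j] has the same ancestors as [j], and [j] is one of them. *)
have jk k : k \in anc j -> connect e j k.
  move=> kC; have kj : connect e k j by move: kC; rewrite inE.
  have : anc k == anc j.
    by rewrite eqEcard anc_sub //= jmin //; exact: connect_trans kj ji.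
  by move/eqP/finset.setP/(_ j); rewrite !inE connect0.
have pred a b : e a b -> b \in anc j -> a \in anc j.
  by rewrite !inE => ab; apply: connect_trans; exact: connect1.
have jC : j \in anc j by rewrite inE connect0.
have sC : strongly_connected e (anc j).
  apply/andP; split; first by apply/finset.set0Pn; exists j.
  apply/forall_inP => x xC; apply/forall_inP => y yC.
  apply: connect_induced => //; apply: (@connect_trans _ _ j).
    by move: xC; rewrite inE.
  exact: jk.
exists (anc j); last by move=> x; rewrite inE => xj; exact: connect_trans xj ji.
split=> [|D /maxsetP[sD maxD] neqD x y xD yC].
  apply/maxsetP; split=> // B sB CB; apply/eqP; rewrite finset.eqEsubset CB andbT.
  apply/fintype.subsetP=> b bB; rewrite inE; apply: strongly_connected_connect sB bB _.
  exact: (fintype.subsetP CB).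
apply: contra neqD => exy; have xC := pred _ _ exy yC.
apply/eqP/esym/maxD => //; apply/fintype.subsetP => d dD; rewrite inE.
move: xC; rewrite inE; apply: connect_trans.
exact: strongly_connected_connect sD dD xD.
Qed.

End Digraph.

(** * Splitting by a dimension count *)

(** The hypothesis says that [Q (ker A)] and the image of [A] meet trivially; as [Q] is invertible,
    their dimensions add up to [n]. Transposes turn both into row spaces. *)
Lemma kernel_image_decomposition (F : fieldType) n (A Q : 'M[F]_n) :
  Q \in unitmx ->
  (forall f u : 'cV[F]_n, A *m f = 0 -> Q *m f = A *m u -> f = 0) ->
  forall c : 'cV[F]_n, exists f u : 'cV[F]_n, A *m f = 0 /\ Q *m (c - f) = A *m u.
Proof.
move=> Qu AQ c; pose V := kermx A^T *m Q^T.
have kerA p (a : 'M[F]_(p, n)) : A *m (a *m kermx A^T)^T = 0.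
  by apply: trmx_inj; rewrite trmx_mul trmxK -mulmxA mulmx_ker mulmx0 trmx0.
have capVA : (V :&: A^T)%MS = 0 :> 'M[F]_n.
  apply/eqP; rewrite -submx0; apply/rV_subP => v; rewrite sub_capmx.
  case/andP=> /submxP[a va] /submxP[b vb].
  have f0 : (a *m kermx A^T)^T = 0.
    apply: (AQ _ b^T) => //; apply: trmx_inj.
    by rewrite trmx_mul trmxK -mulmxA -[in LHS]va vb trmx_mul trmxK.
  by rewrite va mulmxA -[a *m _]trmxK f0 trmx0 mul0mx sub0mx.
have fullVA : row_full (V + A^T)%MS.
  rewrite /row_full mxrank_disjoint_sum // mxrankMfree ?mxrank_ker.
    by rewrite subnK ?rank_leq_row.
  by rewrite row_free_unit unitmx_tr.
have /sub_addsmxP[[a b] /= eab] := submx_full (c^T *m Q^T) fullVA.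
exists (a *m kermx A^T)^T, b^T; split; first exact: kerA.
rewrite mulmxBr; apply: trmx_inj; rewrite !linearB /= !trmx_mul !trmxK eab.
by rewrite /V mulmxA addrAC subrr add0r.
Qed.

(** * Weighted sums and upper limits *)

Section RealEstimates.
Variable R : realType.

(** The terms other than [j] contribute at most [(1 - |w j|) * B], so term [j] must supply the
    rest. *)
Lemma weighted_sum_close (T : finType) (w v : T -> R) (B delta : R) s j :
  \sum_i `|w i| = 1 -> (forall i, `|v i| <= B) ->
  B - delta < (-1) ^+ s * \sum_i w i * v i ->
  `|w j| * B - delta < (-1) ^+ s * (w j * v j).
Proof.
move=> w1 vB; rewrite (bigD1 j) //= mulrDr.
have rest : (-1) ^+ s * \sum_(i | i != j) w i * v i <= (1 - `|w j|) * B.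
  apply: (le_trans (ler_norm _)); rewrite normrMsign.
  apply: (le_trans (ler_norm_sum _ _ _)).
  have -> : 1 - `|w j| = \sum_(i | i != j) `|w i|.
    by rewrite -w1 (bigD1 j) //= [X in X - _]addrC addrK.
  rewrite mulr_suml; apply: ler_sum => i _.
  by rewrite normrM ler_wpM2l.
lra.
Qed.

Lemma limsup_fin_attained (T : finType) (i0 : T) (u : T -> nat -> R) (M : R) :
  (forall i k, 0 <= u i k <= M) ->
  exists D : R, (forall eta, 0 < eta ->
      \forall k \near \oo, forall i, u i k <= D + eta) /\
    exists i, forall zeta, 0 < zeta -> forall K : nat,
      exists2 k, (K <= k)%N & D - zeta < u i k.
Proof.
(* The infimum of the eventual upper bounds [E i] is the limsup of [u i]. *)
move=> uM; pose E i := [set B : R | \forall k \near \oo, u i k <= B].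
have Einf i : has_inf (E i).
  split; first by exists M; apply: nearW => k; case/andP: (uM i k).
  exists 0 => B [K _ HK]; apply: (le_trans _ (HK K (leqnn K))).
  by case/andP: (uM i K).
have [i Dmax] : exists i, forall j, inf (E j) <= inf (E i).
  case: (@arg_maxP _ _ _ i0 xpredT (fun i => inf (E i)) isT) => i _ H.
  by exists i => j; exact: H.
exists (inf (E i)); split=> [eta eta0|].
  apply: filter_forall => j.
  have [B EB Blt] := inf_adherent eta0 (Einf j).
  apply: filterS EB => k /le_trans; apply; apply: ltW; apply: lt_le_trans Blt _.
  by rewrite lerD2r.
exists i => zeta zeta0 K; apply: contrapT => nex.
have /(ge_inf (proj2 (Einf i))) : E i (inf (E i) - zeta).
  exists K => // k /= Kk; rewrite leNgt; apply/negP => ltk; apply: nex.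
  by exists k.
lra.
Qed.

End RealEstimates.

(** * Solutions with arbitrary history *)

Section DelayedSystem.
Variables (R : realType) (n tau : nat) (W : 'M[R]_n).
Hypothesis W1 : forall i, \sum_j `|W i j| = 1.
Implicit Types (X Z : nat -> 'cV[R]_n).

(** The history on [0..tau] is left free, so that increments and partial sums of solutions can be
    solutions too. *)
Definition delayed_solution X : Prop :=
  forall k, X (k + tau).+1 = What W *m X (k + tau)%N + Wtilde W *m X k.

Lemma delayed_solution_coord X i k : delayed_solution X ->
  X (k + tau).+1 i 0 =
  \sum_j W i j * X (if j == i then k + tau else k)%N j 0.
Proof.
move=> ->; rewrite /Wtilde mulmxBl /What !mul_diag_mx !mxE.
rewrite (bigD1 i) //= [RHS](bigD1 i) //= eqxx.
rewrite [W i i * X k i 0 + _]addrC addrK; congr (_ + _).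
by apply: eq_bigr => j /negPf ->.
Qed.

Lemma delayed_solution_bounded X (M : R) : delayed_solution X ->
  (forall k i, (k <= tau)%N -> `|X k i 0| <= M) ->
  forall k i, `|X k i 0| <= M.
Proof.
move=> solX XM; elim/ltn_ind => k IH i.
have [/XM//|ltk] := leqP k tau.
have [m km] : exists m, k = (m + tau).+1 by exists (k - tau.+1)%N; lia.
rewrite km delayed_solution_coord //; apply: (le_trans (ler_norm_sum _ _ _)).
apply: (@le_trans _ _ (\sum_j `|W i j| * M)); last by rewrite -mulr_suml W1 mul1r.
apply: ler_sum => j _; rewrite normrM ler_wpM2l //; apply: IH.
by rewrite km; case: ifP => _; lia.
Qed.

Lemma delayed_solution_is_bounded X : delayed_solution X ->
  exists M : R, forall k i, `|X k i 0| <= M.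
Proof.
move=> solX; exists (\sum_(k < tau.+1) \sum_i `|X k i 0|).
apply: delayed_solution_bounded => // k i; rewrite -ltnS => ltk.
rewrite (bigD1 (Ordinal ltk)) //= (bigD1 i) //= -addrA lerDl.
by rewrite addr_ge0 ?sumr_ge0 // => j _; rewrite sumr_ge0.
Qed.

(** * Propagating large values backwards along edges *)

Section Backtracking.
Variables (X : nat -> 'cV[R]_n) (D : R).
Hypothesis solX : delayed_solution X.
Hypothesis XD : forall eta, 0 < eta ->
  \forall k \near \oo, forall i, `|X k i 0| <= D + eta.

Definition recurrently_large i : Prop :=
  forall zeta, 0 < zeta -> forall K : nat,
  exists2 k, (K <= k)%N & D - zeta < `|X k i 0|.

Lemma backtrack i j (zeta : R) : W i j != 0 -> 0 < zeta ->
  exists2 zeta' : R, 0 < zeta' & exists K : nat, forall k, (K <= k)%N ->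
  forall s : bool, D - zeta' < (-1) ^+ s * X (k + tau).+1 i 0 ->
  D - zeta < (-1) ^+ (s (+) (W i j < 0)) *
    X (if j == i then k + tau else k)%N j 0.
Proof.
move=> Wij zeta0; have a0 : 0 < `|W i j| by rewrite normr_gt0.
(* The bound [D + eta] and the value [D - eta] differ by [|W i j| * zeta]; dividing by the weight
   leaves a loss of [zeta]. *)
pose eta := `|W i j| * zeta / 2.
have eta0 : 0 < eta by rewrite divr_gt0 // mulr_gt0.
exists eta => //; have [K _ HK] := XD eta0.
exists K => k Kk s; rewrite delayed_solution_coord // => Hs.
have XB l : `|X (if l == i then k + tau else k)%N l 0| <= D + eta.
  by apply: HK; rewrite /=; case: ifP => _; lia.
have := @weighted_sum_close _ _ (W i) _ (D + eta) (eta + eta) s j (W1 i) XB.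
have -> : D + eta - (eta + eta) = D - eta by ring.
move/(_ Hs); rewrite [W i j in X in _ < X -> _]numEsign -mulrA mulrCA.
rewrite [X in _ < X -> _]mulrA mulrCA -signr_addb addbC.
move=> H; rewrite -(ltr_pM2l a0). apply: le_lt_trans H.
have : eta + eta = `|W i j| * zeta by rewrite /eta; field.
have := mulr_gt0 a0 eta0; rewrite mulrBr mulrDr; lra.
Qed.

Lemma recurrently_large_step i j :
  W i j != 0 -> recurrently_large i -> recurrently_large j.
Proof.
move=> Wij large_i zeta zeta0 K.
have [zeta' zeta'0 [K0 HK0]] := backtrack Wij zeta0.
have [k lek Dk] := large_i _ zeta'0 ((maxn K K0 + tau).+1).
have [m km] : exists m, k = (m + tau).+1 by exists (k - tau.+1)%N; lia.
have [s es] : exists s : bool, `|X k i 0| = (-1) ^+ s * X k i 0.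
  by eexists; exact: normrEsign.
move: Dk; rewrite es km => /HK0-/(_ ltac:(lia)) /lt_le_trans H.
exists (if j == i then m + tau else m)%N; first by case: ifP => _; lia.
by apply: H; rewrite -(normrMsign (s (+) (W i j < 0))) ler_norm.
Qed.

Lemma recurrently_large_connect i j :
  connect (edge W) j i -> recurrently_large i -> recurrently_large j.
Proof.
case/connectP=> p; elim: p j => [|x p IH] j /=; first by move=> _ ->.
case/andP=> jx px ilast large_i.
by apply: recurrently_large_step jx _; exact: IH px ilast large_i.
Qed.

(* With a positive self-loop weight, going one step back keeps both the node and
   the sign, hence the runs of arbitrary length at constant sign. *)
Lemma recurrently_large_run i : 0 < W i i -> recurrently_large i ->
  forall (L : nat) zeta, 0 < zeta -> forall K : nat,
  exists2 k, (K <= k)%N &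
  exists s : bool, forall l, (l <= L)%N ->
    D - zeta < (-1) ^+ s * X (k + l)%N i 0.
Proof.
move=> Wii large_i; elim=> [|L IH] zeta zeta0 K.
  have [k Kk Dk] := large_i _ zeta0 K; exists k => //.
  exists (X k i 0 < 0) => l; rewrite leqn0 => /eqP ->.
  by rewrite addn0 -normrEsign.
have [zeta' zeta'0 [K0 HK0]] := backtrack (lt0r_neq0 Wii) zeta0.
(* [zeta] serves the run already found, [zeta'] the step back from its first time [k] to [k - 1]. *)
have min0 : 0 < Num.min zeta zeta' by rewrite lt_min zeta0.
have [k lek [s Hs]] := IH _ min0 ((maxn K K0 + tau).+1).
have [m km] : exists m, k = (m + tau).+1 by exists (k - tau.+1)%N; lia.
exists (m + tau)%N; first by lia.
exists s => -[_|l ltl].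
  have := HK0 m ltac:(lia) s; rewrite eqxx addn0.
  rewrite [W i i < 0]ltNge (ltW Wii) addbF; apply.
  have := Hs 0%N isT; rewrite addn0 km; apply: le_lt_trans.
  by rewrite lerD2l lerN2 ge_min lexx orbT.
have -> : (m + tau + l.+1 = k + l)%N by lia.
by apply: le_lt_trans (Hs l ltl); rewrite lerD2l lerN2 ge_min lexx.
Qed.

End Backtracking.

(** * Vanishing increments *)

Hypothesis self_loop_upstream : forall i, exists2 s, connect (edge W) s i & 0 < W s s.

Lemma difference_vanishes Z : delayed_solution Z ->
  forall eps, 0 < eps ->
  \forall k \near \oo, forall i, `|(Z k.+1 - Z k) i 0| <= eps.
Proof.
move=> solZ eps eps0.
have [M ZM] := delayed_solution_is_bounded solZ.
case: (pickP 'I_n) => [i0 _|no_i]; last by apply: nearW => k i; have := no_i i.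
pose X k := Z k.+1 - Z k.
have solX : delayed_solution X.
  move=> k; rewrite /X (solZ k) !mulmxBr addrACA -opprD -(solZ k).
  by rewrite -(solZ k.+1).
have XM i k : 0 <= `|X k i 0| <= M + M.
  rewrite normr_ge0 /= !mxE; apply: (le_trans (ler_normB _ _)).
  by apply: lerD.
have [D [XD [i large_i]]] := limsup_fin_attained i0 XM.
have [D0|D0] := leP D 0.
  apply: filterS (XD _ eps0) => k H i1; apply: (le_trans (H i1)).
  by rewrite gerDr.
exfalso; have [s cs Wss] := self_loop_upstream i.
have large_s := recurrently_large_connect solX XD cs large_i.
have D20 : 0 < D / 2 by rewrite divr_gt0.
(* This makes [L * (D / 2)] exceed [2 * M], the largest possible change of a coordinate of [Z]. *)
pose L := (Num.truncn (4 * M / D)).+1.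
have [k _ [t Ht]] := recurrently_large_run solX XD Wss large_s L D20 0%N.
have telescope : \sum_(0 <= l < L) X (k + l)%N s 0 = (Z (k + L)%N - Z k) s 0.
  rewrite -summxE; congr (fun_of_matrix _ s 0).
  rewrite (eq_bigr (fun l => Z (k + l.+1)%N - Z (k + l)%N)).
    by rewrite (telescope_sumr (fun l => Z (k + l)%N)) ?addn0.
  by move=> l _; rewrite /X addnS.
have lower : L%:R * (D / 2) <= (-1) ^+ t * (Z (k + L)%N - Z k) s 0.
  rewrite -telescope mulr_sumr.
  rewrite mulr_natl -[L in _ *+ L]subn0 -sumr_const_nat.
  rewrite !big_nat; apply: ler_sum => l /andP[_ ltl].
  by apply/ltW; apply: le_lt_trans (Ht l (ltnW ltl)); lra.
have upper : (-1) ^+ t * (Z (k + L)%N - Z k) s 0 <= M + M.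
  apply: (le_trans (ler_norm _)); rewrite normrMsign !mxE.
  by apply: (le_trans (ler_normB _ _)); apply: lerD.
have : 4 * M / D < L%:R by exact: truncnS_gt.
rewrite ltr_pdivrMr //.
lra.
Qed.

(** * Constant histories and convergence *)

(* Starting from the constant history [b], the sums [z k = u + \sum_(l < k) X l]
   begin with [u, u + b, u + 2 b, ...]; they obey the recursion at time [tau]
   exactly when [history_mx *m b = (W - 1) *m u]. *)
Definition history_mx : 'M[R]_n := diag_mx (\row_i (1 + tau%:R * (1 - W i i))).

Lemma history_mxE (b : 'cV[R]_n) :
  history_mx *m b = b + tau%:R *: (b - What W *m b).
Proof.
apply/matrixP => i j; rewrite /What !mul_diag_mx !mxE; ring.
Qed.

(** Each diagonal entry is at least 1, since [W i i <= 1]. *)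
Lemma history_mx_unit : history_mx \in unitmx.
Proof.
rewrite unitmxE det_diag unitfE; apply/prodf_neq0 => i _; rewrite mxE.
apply: lt0r_neq0; apply: ltr_wpDr => //; apply: mulr_ge0 => //.
rewrite subr_ge0 (le_trans (ler_norm _)) // -(W1 i) (bigD1 i) //= lerDl.
exact: sumr_ge0.
Qed.

Lemma summation_solution X (b u : 'cV[R]_n) : delayed_solution X ->
  (forall k, (k <= tau)%N -> X k = b) ->
  history_mx *m b = (W - 1%:M) *m u ->
  delayed_solution (fun k => u + \sum_(l < k) X l).
Proof.
move=> solX Xb; rewrite history_mxE => eb.
pose S m := u + \sum_(l < m) X l.
have SS m : S m.+1 = S m + X m by rewrite /S big_ord_recr /= addrA.
(* Only the first instance uses the equation on [b] and [u]; each later one adds the recursion of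
   [X] to the previous one. *)
rewrite -/S; elim=> [|k IH].
  rewrite /S add0n big_ord0 addr0.
  (* The range includes [tau.+1], as that sum still only involves [X 0, ..., X tau]. *)
  have sumb m : (m <= tau.+1)%N -> \sum_(l < m) X l = m%:R *: b.
    move=> lem; rewrite (eq_bigr (fun=> b)) ?sumr_const ?card_ord ?scaler_nat //.
    by move=> l _; apply: Xb; have := ltn_ord l; lia.
  rewrite !sumb // /Wtilde mulmxBl mulmxDr -scalemxAr.
  move: eb; rewrite mulmxBl mul1mx -natr1 => /eqP; rewrite -subr_eq0 => /eqP eb.
  apply/eqP; rewrite -subr_eq0; apply/eqP; rewrite -eb.
  apply/matrixP => i j; rewrite !mxE.
  ring.
by rewrite addSn SS [in LHS]IH solX addrACA -!mulmxDr -!SS.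
Qed.

Lemma solution_vanishes X (b u : 'cV[R]_n) : delayed_solution X ->
  (forall k, (k <= tau)%N -> X k = b) ->
  history_mx *m b = (W - 1%:M) *m u ->
  forall eps, 0 < eps -> \forall k \near \oo, forall i, `|X k i 0| <= eps.
Proof.
move=> solX Xb eb eps eps0.
apply: filterS (difference_vanishes (summation_solution solX Xb eb) eps0).
by move=> k H i; have := H i; rewrite big_ord_recr /= opprD addrACA subrr add0r
  addrAC subrr add0r.
Qed.

Lemma fixed_vector_solution (f : 'cV[R]_n) :
  (W - 1%:M) *m f = 0 -> delayed_solution (fun=> f).
Proof.
rewrite mulmxBl mul1mx => /subr0_eq Wf k.
by rewrite /Wtilde mulmxBl Wf addrC subrK.
Qed.

Lemma constant_history_converges X : delayed_solution X ->
  (forall k, (k <= tau)%N -> X k = X 0%N) ->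
  exists L : 'cV[R]_n, X k @[k --> \oo] --> L.
Proof.
move=> solX X0.
have [|f [u [Wf eb]]] := @kernel_image_decomposition _ _ (W - 1%:M) _
    history_mx_unit _ (X 0%N).
  (* The constant solution [f] vanishes in the limit, so each entry is below every [eps]. *)
  move=> f u Wf Qf; apply/colP => i; rewrite mxE; apply/eqP.
  rewrite -normr_le0; apply/ler_addgt0Pr => eps eps0; rewrite add0r.
  have [K _ HK] := solution_vanishes (fixed_vector_solution Wf) (fun _ _ => erefl)
    Qf eps0.
  exact: (HK K (leqnn K)).
exists f; apply/cvgrPdist_le => eps eps0.
(* By linearity [X - f] is a solution; its constant history is the component [b = X 0 - f] of the
   splitting. *)
have solY : delayed_solution (fun k => X k - f).
  move=> k; rewrite solX {1}(fixed_vector_solution Wf k) !mulmxBr.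
  by rewrite opprD addrACA.
have Y0 k : (k <= tau)%N -> X k - f = X 0%N - f by move/X0 ->.
apply: filterS (solution_vanishes solY Y0 eb eps0) => k H.
rewrite distrC [leLHS]/Num.Def.normr/= mx_normrE; apply: bigmax_le (ltW eps0) _.
by move=> [i j] _; rewrite ord1 /=; exact: H.
Qed.

End DelayedSystem.

Theorem theorem1 (R : realType) (n : nat) (hn : (1 <= n)%N) (tau : nat)
    (W : 'M[R]_n)
    (hW : signed_stochastic W)
    (hdiag : forall i, 0 <= W i i)
    (hloop : forall C : {set 'I_n}, is_CSCC (edge W) C ->
       exists2 i, i \in C & 0 < W i i) :
  forall X : nat -> 'cV[R]_n,
    (forall i, -1 <= X 0%N i 0 <= 1) ->
    delayed_trajectory tau W X ->
    exists L : 'cV[R]_n, X k @[k --> \oo] --> L.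
Proof.
move=> X _ [X0 Xrec].
have upstream i : exists2 s, connect (edge W) s i & 0 < W s s.
  have [C CC Ci] := CSCC_reaches (edge W) i.
  by have [s sC Wss] := hloop _ CC; exists s => //; exact: Ci.
apply: (constant_history_converges (tau := tau) hW.2 upstream _ X0) => k.
by rewrite Xrec ?leq_addl // addnK.
Qed.
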